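(* Let $G$ and $H$ be graphs with connected components $G_1,\dots,G_k$ and $H_1,\dots,H_\ell$ respectively, and suppose $V=(v_{si})\in\mathbb{N}_0^{r\times k}$ (with $r\ge3$) is a sane multiplicity matrix for $G$ and $W=(w_{sj})\in\mathbb{N}_0^{r\times\ell}$ is a sane multiplicity matrix for $H$, and $V,W$ are compatible. Write $p=(p_2,\dots,p_{r-1})^\top:=\widetilde V\mathbf 1_k=\widetilde W\mathbf 1_\ell$ (indexing rows of $\widetilde V$ by $2,\dots,r-1$). Then $q(G\vee H)\le 2$ if at least one of the following holds: (a) whenever $(\widetilde V^\top\widetilde W)_{ij}\ge 2$, there exists $s\in\{2,\dots,r-1\}$ with $v_{si}w_{sj}\ne 0$ and $p_s\ge 2$; (b) $V$ is a generically realisable multiplicity matrix for $G$; (c) $W$ is a generically realisable multiplicity matrix for $H$.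
   Context: Graphs are finite, simple, with nonempty vertex sets; $G\vee H$ is the join. $S(G)$ is the set of real symmetric matrices whose off-diagonal nonzero pattern is the edge set of $G$ (diagonal free); $q(G)$ is the minimum number of distinct eigenvalues of a matrix in $S(G)$. $\mathbb{N}_0=\{0,1,2,\dots\}$. For $\Lambda=(\lambda_1,\dots,\lambda_r)$ and $v\in\mathbb{N}_0^r$, $D_{\Lambda,v}=\bigoplus_i\lambda_iI_{v_i}$. For a connected graph $G$ on $n$ vertices, $v\in\mathbb{N}_0^r$ is a multiplicity vector for $G$ if $\sum v_i=n$ and there are $\lambda_1<\dots<\lambda_r$ and an orthogonal $U$ with $UD_{\Lambda,v}U^\top\in S(G)$. It is sane for $G$ if for every $\lambda_1<\dots<\lambda_r$ there is a nowhere-zero (no zero entries) orthogonal $U$ with $UD_{\Lambda,v}U^\top\in S(G)$; it is generically realisable for $G$ if for every $\lambda_1<\dots<\lambda_r$ and every finite set $\mathcal Y\subseteq\mathbb{R}^n\setminus\{0\}$ such a $U$ can be chosen so that additionally $Uy$ is nowhere-zero for all $y\in\mathcal Y$. A multiplicity matrix for $G$ (components $G_1,\dots,G_k$) is $V\in\mathbb{N}_0^{r\times k}$ whose $i$th column is a multiplicity vector for $G_i$; it is sane / generically realisable if every column is sane / generically realisable for the corresponding component. $\widetilde X$ is $X$ with first and last rows deleted; $V\in\mathbb{N}_0^{r\times k}$, $W\in\mathbb{N}_0^{r\times \ell}$ ($r\ge 3$) are compatible if $\widetilde V\mathbf 1_k=\widetilde W\mathbf 1_\ell$ and $\widetilde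 V^\top\widetilde W$ has all entries positive. *)

(* Defs.v *)
From HB Require Import structures.
From mathcomp Require Import all_boot all_order all_algebra finmap.
From mathcomp Require Import boolp classical_sets cardinality reals.

Set Implicit Arguments.
Unset Strict Implicit.
Unset Printing Implicit Defensive.

Import Order.TTheory GRing.Theory Num.Theory.
Local Open Scope ring_scope.

Record sgraph := SGraph {
  vertex :> finType;
  adj : rel vertex;
  adj_sym : symmetric adj;
  adj_irr : irreflexive adj }.

Definition induced_adj (G : sgraph) (A : {set G}) : rel {x : G | x \in A} :=
  fun x y => adj (val x) (val y).

Lemma induced_adj_sym (G : sgraph) (A : {set G}) : symmetric (@induced_adj G A).
Proof. by move=> x y; apply: adj_sym. Qed.

Lemma induced_adj_irr (G : sgraph) (A : {set G}) :
  irreflexive (@induced_adj G A).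
Proof. by move=> x; apply: adj_irr. Qed.

Definition induced (G : sgraph) (A : {set G}) : sgraph :=
  SGraph (@induced_adj_sym G A) (@induced_adj_irr G A).

Definition join_adj (G H : sgraph) : rel (G + H) :=
  fun x y => match x, y with
             | inl a, inl b => adj a b
             | inr a, inr b => adj a b
             | _, _ => true
             end.

Lemma join_adj_sym (G H : sgraph) : symmetric (@join_adj G H).
Proof. by move=> [x|x] [y|y] //=; apply: adj_sym. Qed.

Lemma join_adj_irr (G H : sgraph) : irreflexive (@join_adj G H).
Proof. by move=> [x|x] /=; apply: adj_irr. Qed.

Definition join (G H : sgraph) : sgraph :=
  SGraph (@join_adj_sym G H) (@join_adj_irr G H).

Definition components (G : sgraph) : {set {set G}} :=
  equivalence_partition (connect (@adj G)) [set: G].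

(* The connected components of G are listed, without repetition, as
   C 0, ..., C (k - 1). *)
Definition lists_components (G : sgraph) (k : nat) (C : 'I_k -> {set G}) : Prop :=
  injective C /\ [set C i | i : 'I_k] = components G.

Section Realisation.

Variable R : realType.

(* The class S(G): row i of the matrix belongs to the vertex enum_val i. *)
Definition in_S (G : sgraph) (A : 'M[R]_#|G|) : Prop :=
  A^T = A /\
  forall i j, i != j -> (A i j != 0) = adj (enum_val i) (enum_val j).

Definition n_eigenvalues (n : nat) (A : 'M[R]_n) : nat :=
  #|` fset_set [set a : R | eigenvalue A a]%classic |%fset.

Lemma n_eigenvalues_ex (G : sgraph) :
  exists d, `[< exists2 A : 'M[R]_#|G|, in_S A & n_eigenvalues A = d >].
Proof.
pose A : 'M[R]_#|G| := \matrix_(i, j) (adj (enum_val i) (enum_val j))%:R.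
exists (n_eigenvalues A); apply/asboolP; exists A => //; split.
  by apply/matrixP=> i j; rewrite !mxE adj_sym.
by move=> i j _; rewrite mxE; case: adj; rewrite ?oner_eq0 ?eqxx.
Qed.

Definition q (G : sgraph) : nat := ex_minn (n_eigenvalues_ex G).

Definition orthogonal_mx (n : nat) (U : 'M[R]_n) : Prop := U *m U^T = 1%:M.

Definition nowhere_zero (m n : nat) (A : 'M[R]_(m, n)) : Prop :=
  forall i j, A i j != 0.

Definition increasing (r : nat) (lam : 'I_r -> R) : Prop :=
  forall i j : 'I_r, (i < j)%N -> lam i < lam j.

(* D_{lam,v}, seen as an n x n matrix; conform_mx performs the cast along
   \sum_i v_i = n, and this matrix is only used when that equality holds. *)
Definition D_mx (n r : nat) (lam : 'I_r -> R) (v : 'cV[nat]_r) : 'M[R]_n :=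
  conform_mx 0 (\mxdiag_(i < r) ((lam i)%:M : 'M[R]_(v i ord0))).

Definition mult_vector (G : sgraph) (r : nat) (v : 'cV[nat]_r) : Prop :=
  (\sum_i v i ord0)%N = #|G| /\
  exists2 lam : 'I_r -> R, increasing lam &
  exists2 U : 'M[R]_#|G|, orthogonal_mx U & in_S (U *m D_mx #|G| lam v *m U^T).

Definition sane (G : sgraph) (r : nat) (v : 'cV[nat]_r) : Prop :=
  mult_vector G v /\
  forall lam : 'I_r -> R, increasing lam ->
  exists U : 'M[R]_#|G|,
    [/\ orthogonal_mx U, nowhere_zero U & in_S (U *m D_mx #|G| lam v *m U^T)].

Definition gen_realisable (G : sgraph) (r : nat) (v : 'cV[nat]_r) : Prop :=
  mult_vector G v /\
  forall lam : 'I_r -> R, increasing lam ->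
  forall Y : {fset 'cV[R]_#|G|}, 0 \notin Y ->
  exists U : 'M[R]_#|G|,
    [/\ orthogonal_mx U, nowhere_zero U,
        in_S (U *m D_mx #|G| lam v *m U^T) &
        forall y, y \in Y -> nowhere_zero (U *m y)].

(* In the next three definitions C lists the components of G. *)
Definition mult_matrix (G : sgraph) (r k : nat) (C : 'I_k -> {set G})
    (V : 'M[nat]_(r, k)) : Prop :=
  forall i, mult_vector (induced (C i)) (col i V).

Definition sane_matrix (G : sgraph) (r k : nat) (C : 'I_k -> {set G})
    (V : 'M[nat]_(r, k)) : Prop :=
  mult_matrix C V /\ forall i, sane (induced (C i)) (col i V).

Definition gen_realisable_matrix (G : sgraph) (r k : nat) (C : 'I_k -> {set G})
    (V : 'M[nat]_(r, k)) : Prop :=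
  mult_matrix C V /\ forall i, gen_realisable (induced (C i)) (col i V).

End Realisation.

(* Row s of the result is row s + 1 of X, counting from 0. *)
Definition inner_rows (m k : nat) (X : 'M[nat]_(m.+2, k)) : 'M[nat]_(m, k) :=
  row' ord_max (row' ord0 X).

Definition inner_sums (m k : nat) (X : 'M[nat]_(m.+2, k)) : 'cV[nat]_m :=
  inner_rows X *m const_mx 1.

Definition compatible (m k l : nat)
    (V : 'M[nat]_(m.+2, k)) (W : 'M[nat]_(m.+2, l)) : Prop :=
  inner_sums V = inner_sums W /\
  forall i j, (0 < ((inner_rows V)^T *m inner_rows W) i j)%N.

(* Main.v *)
Require Import Defs.
From HB Require Import structures.
From mathcomp Require Import all_boot all_order all_algebra finmap.
From mathcomp Require Import boolp classical_sets cardinality reals ring.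

Set Implicit Arguments.
Unset Strict Implicit.
Unset Printing Implicit Defensive.

Import Order.TTheory GRing.Theory Num.Theory.
Local Open Scope ring_scope.

(* Choose lam_1 = -1 < ... < lam_r = 1 and realise the columns of V and W with
   this spectrum, giving A = Phi L Phi^T in S(G) and C = Psi L' Psi^T in S(H)
   with Phi and Psi orthogonal and block diagonal over the components.  If M
   maps the lam_s-part of L' to that of L as sqrt (1 - lam_s^2) times an
   orthogonal map, then with B = Phi M Psi^T the matrix [[A, B], [B^T, -C]]
   squares to 1, so it has at most two eigenvalues, and it lies in S(G v H) as
   soon as B has no zero entry.  The freedom in M is a Householder reflection
   in each eigenspace; an entry of B is, up to a nonzero factor, a polynomial
   in the vectors defining the reflections.  In case (a) each of these
   polynomials is nonzero, so a generic choice works.  In case (b) a generic M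
   only ensures that the columns of M Psi^T do not vanish on any component of
   G, and generic realisability then provides Phi; case (c) is the transpose
   of (b). *)

(** * Functions that are polynomial along lines *)

Section GenericPoint.

Variable R : realFieldType.

(** In characteristic zero the naturals below the size of [p] are distinct points, too many of them
    to be all roots. *)
Lemma poly_nonroot (p : {poly R}) : p != 0 -> exists t, p.[t] != 0.
Proof.
move=> p0; apply: contrapT => nt.
pose s := [seq i%:R : R | i <- iota 0 (size p)].
have us : uniq s by rewrite map_inj_uniq ?iota_uniq //; apply: mulrIn; rewrite oner_eq0.
have rs : all (root p) s.
  apply/allP => x _; rewrite /root; apply: contrapT => /negP px.
  by apply: nt; exists x.
by have := max_poly_roots p0 rs us; rewrite size_map size_iota ltnn.
Qed.

(** Genericity is only ever tested along a line, so this one-variable notion stands in for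
    multivariate polynomials. *)
Definition poly_on_lines n (F : 'rV[R]_n -> R) : Prop :=
  forall w d, exists p : {poly R}, forall t, F (w + t *: d) = p.[t].

Section Closure.
Variable n : nat.
Implicit Types F : 'rV[R]_n -> R.

Lemma poly_on_lines_cst c : poly_on_lines (fun _ : 'rV[R]_n => c).
Proof. by move=> w d; exists c%:P => t; rewrite hornerC. Qed.

Lemma poly_on_lines_coord a : poly_on_lines (fun w : 'rV[R]_n => w 0 a).
Proof.
by move=> w d; exists ((w 0 a)%:P + (d 0 a)%:P * 'X) => t; rewrite !hornerE !mxE mulrC.
Qed.

Lemma poly_on_linesM F1 F2 : poly_on_lines F1 -> poly_on_lines F2 ->
  poly_on_lines (fun w => F1 w * F2 w).
Proof.
move=> h1 h2 w d; have [[p1 e1] [p2 e2]] := (h1 w d, h2 w d).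
by exists (p1 * p2) => t; rewrite hornerM e1 e2.
Qed.

Lemma poly_on_linesB F1 F2 : poly_on_lines F1 -> poly_on_lines F2 ->
  poly_on_lines (fun w => F1 w - F2 w).
Proof.
move=> h1 h2 w d; have [[p1 e1] [p2 e2]] := (h1 w d, h2 w d).
by exists (p1 - p2) => t; rewrite hornerD hornerN e1 e2.
Qed.

Lemma poly_on_lines_sum (I : Type) (r : seq I) (P : pred I) (F : I -> 'rV[R]_n -> R) :
  (forall i, poly_on_lines (F i)) ->
  poly_on_lines (fun w => \sum_(i <- r | P i) F i w).
Proof.
move=> h w d; elim: r => [|i r [p e]].
  by exists 0 => t; rewrite big_nil horner0.
have [pi ei] := h i w d.
exists (if P i then pi + p else p) => t; rewrite big_cons e.
by case: (P i); rewrite // hornerD ei.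
Qed.

Lemma poly_on_lines_prod (I : Type) (r : seq I) (P : pred I) (F : I -> 'rV[R]_n -> R) :
  (forall i, poly_on_lines (F i)) ->
  poly_on_lines (fun w => \prod_(i <- r | P i) F i w).
Proof.
move=> h w d; elim: r => [|i r [p e]].
  by exists 1 => t; rewrite big_nil hornerC.
have [pi ei] := h i w d.
exists (if P i then pi * p else p) => t; rewrite big_cons e.
by case: (P i); rewrite // hornerM ei.
Qed.

(* On the line joining a point that is good for the first conditions to a
   point that is good for the next one, the product of all the conditions is
   a nonzero polynomial. *)
Lemma generic_point (I : eqType) (r : seq I) (F : I -> 'rV[R]_n -> R) :
  (forall i, poly_on_lines (F i)) ->
  (forall i, i \in r -> exists w, F i w != 0) ->
  exists w, forall i, i \in r -> F i w != 0.
Proof.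
move=> hF; elim: r => [|i r IH] hr; first by exists 0.
have [w0 hw0] : exists w, forall j, j \in r -> F j w != 0.
  by apply: IH => j jr; apply: hr; rewrite inE jr orbT.
have [w1 hw1] := hr i (mem_head _ _).
have [p e] := hF i w0 (w1 - w0).
have [p' e'] := @poly_on_lines_prod _ r xpredT F hF w0 (w1 - w0).
have p0 : p != 0.
  apply: contraNneq hw1 => p0; have := e 1.
  by rewrite p0 horner0 scale1r addrC subrK => ->.
have p'0 : p' != 0.
  apply: contraTneq isT => p'0; have := e' 0.
  rewrite p'0 horner0 scale0r addr0 => /eqP.
  rewrite prodf_seq_eq0 => /hasP[j jr /=].
  by rewrite (negPf (hw0 j jr)).
have [t] := poly_nonroot (mulf_neq0 p0 p'0).
rewrite hornerM -e -e' mulf_eq0 negb_or => /andP[h1 h2].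
exists (w0 + t *: (w1 - w0)) => j; rewrite inE => /predU1P[->//|jr].
by move: h2; rewrite prodf_seq_neq0 => /allP/(_ j jr).
Qed.

End Closure.
End GenericPoint.

(** * Reflections acting within the classes of an index set *)

Section Reflection.

Variables (R : realFieldType) (n : nat) (I : eqType) (sg : 'I_n -> I).
Implicit Types (w : 'rV[R]_n) (u t : 'I_n -> R).

Definition class_norm2 w a := \sum_(b | sg b == sg a) w 0 b ^+ 2.

(** The orthogonal projection onto the span of the restrictions of [w] to the classes of [sg]; its
    block on a class is w w^T / |w|^2. *)
Definition class_proj w : 'M[R]_n :=
  \matrix_(a, b) if sg b == sg a then w 0 a * w 0 b / class_norm2 w a else 0.

(* Where w vanishes on a class, the convention 1/0 = 0 makes this the
   identity on that class, so it is an orthogonal matrix for every w. *)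
Definition class_reflection w : 'M[R]_n := 1%:M - 2%:R *: class_proj w.

Lemma eq_class_norm2 w a b : sg a = sg b -> class_norm2 w a = class_norm2 w b.
Proof. by rewrite /class_norm2 => ->. Qed.

Lemma class_reflection_tr w : (class_reflection w)^T = class_reflection w.
Proof.
apply/matrixP => a b; rewrite !mxE eq_sym [sg a == _]eq_sym.
case: (sg b =P sg a) => // e; congr (_ - _ * _).
by rewrite (eq_class_norm2 w e); ring.
Qed.

Lemma class_proj_idem w : class_proj w *m class_proj w = class_proj w.
Proof.
apply/matrixP => a b; rewrite !mxE.
under eq_bigr do rewrite !mxE.
have -> : (\sum_c (if sg c == sg a then w 0 a * w 0 c / class_norm2 w a else 0) *
          (if sg b == sg c then w 0 c * w 0 b / class_norm2 w c else 0)) =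
  (if sg b == sg a then w 0 a * w 0 b / class_norm2 w a ^+ 2 * class_norm2 w a else 0).
  rewrite {3}/class_norm2.
  case: (sg b =P sg a) => ba; last first.
    rewrite big1 // => c _; case: (sg c =P sg a) => [->|]; last by rewrite mul0r.
    by case: eqP => // _; rewrite mulr0.
  rewrite mulr_sumr [RHS]big_mkcond; apply: eq_bigr => c _ /=.
  case: (sg c =P sg a) => [ca|]; last by rewrite mul0r.
  by rewrite ca ba eqxx (eq_class_norm2 w ca) -exprVn; ring.
(* If the norm is 0, both sides vanish because the inverse of 0 is 0. *)
case: eqP => // _; have [->|N0] := eqVneq (class_norm2 w a) 0.
  by rewrite invr0 !mulr0.
by field.
Qed.

Lemma class_reflection_sq w : class_reflection w *m class_reflection w = 1%:M.
Proof.
rewrite /class_reflection mulmxBl !mulmxBr !mul1mx mulmx1 -scalemxAl -scalemxAr.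
by rewrite class_proj_idem; apply/matrixP => a b; rewrite !mxE; ring.
Qed.

Definition reflection_form u t w : R :=
  \sum_a \sum_b u a * class_reflection w a b * t b.

Lemma reflection_formE u t w : reflection_form u t w =
  \sum_a u a * t a -
  2%:R * \sum_a \sum_(b | sg b == sg a) u a * t b * w 0 a * w 0 b / class_norm2 w a.
Proof.
rewrite mulr_sumr -sumrB; apply: eq_bigr => a _.
under eq_bigr => b _ do rewrite !mxE mulrBr mulrBl.
rewrite sumrB; congr (_ - _).
  rewrite (bigD1 a) //= eqxx mulr1 big1 ?addr0 // => b /negPf ba.
  by rewrite eq_sym ba mulr0 mul0r.
rewrite mulr_sumr [RHS]big_mkcond; apply: eq_bigr => b _ /=.
by case: ifP => _; ring.
Qed.

(** This is [reflection_form] with its denominators cleared, hence polynomial along lines. The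
    products run over indices rather than classes; repeated factors do no harm. *)
Definition cleared_form u t w : R :=
  (\prod_c class_norm2 w c) * (\sum_a u a * t a) -
  2%:R * \sum_a \sum_(b | sg b == sg a)
    u a * t b * w 0 a * w 0 b * \prod_(c | c != a) class_norm2 w c.

Lemma cleared_formE u t w : (forall a, class_norm2 w a != 0) ->
  cleared_form u t w = (\prod_c class_norm2 w c) * reflection_form u t w.
Proof.
move=> N0; rewrite reflection_formE mulrBr /cleared_form; congr (_ - _).
rewrite mulrCA; congr (_ * _); rewrite mulr_sumr; apply: eq_bigr => a _.
rewrite mulr_sumr; apply: eq_bigr => b _.
by rewrite [in RHS](bigD1 a) //=; field.
Qed.

Lemma poly_class_norm2 a : poly_on_lines (fun w => class_norm2 w a).
Proof.
apply: poly_on_lines_sum => b.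
by apply: poly_on_linesM; apply: poly_on_lines_coord.
Qed.

Lemma poly_cleared_form u t : poly_on_lines (cleared_form u t).
Proof.
have hN := poly_class_norm2.
apply: poly_on_linesB; apply: poly_on_linesM.
- exact: poly_on_lines_prod.
- exact: poly_on_lines_cst.
- exact: poly_on_lines_cst.
apply: poly_on_lines_sum => a; apply: poly_on_lines_sum => b.
apply: poly_on_linesM; last exact: poly_on_lines_prod.
do 2?[apply: poly_on_linesM; last exact: poly_on_lines_coord].
exact: poly_on_lines_cst.
Qed.

(** A criterion for [reflection_form u t] to be nonzero somewhere. On a one-element class the
    reflection is -1 for every nonvanishing [w], so several such classes could cancel; hence the
    class must have a second element or be the only one that contributes. *)
Definition transverse u t : Prop :=
  exists a b, [/\ sg a = sg b, u a != 0, t b != 0 &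
    (exists2 c, c != a & sg c = sg a) \/
    (forall a' b', sg a' = sg b' -> u a' != 0 -> t b' != 0 -> sg a' = sg a)].

Lemma class_norm2_neq0 w a b : sg b = sg a -> w 0 b != 0 -> class_norm2 w a != 0.
Proof.
move=> ba wb; rewrite gt_eqF // /class_norm2 (bigD1 b) ?ba //=.
rewrite ltr_wpDr ?exprn_even_gt0 //.
by apply: sumr_ge0 => c _; rewrite sqr_ge0.
Qed.

(** If [a] is alone in its class, the all-ones vector gives - u_a t_a. Otherwise let only the part x
    of [w] on that class vary: the form is E - 2 (u.x)(t.x) / |x|^2 with E constant, and it cannot
    vanish both where u.x = 0 and where (u.x)(t.x) is nonzero. *)
Lemma transverse_witness u t : transverse u t ->
  exists2 w, (forall a, class_norm2 w a != 0) & reflection_form u t w != 0.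
Proof.
case=> a [b] [ab ua tb].
case: (pselect (exists2 c, c != a & sg c = sg a)) => [[c ca sca] _|nc]; last first.
  case=> [//|only]; exists (const_mx 1).
    by move=> d; apply: (@class_norm2_neq0 _ _ d); rewrite // mxE oner_eq0.
  have single d : sg d = sg a -> d = a.
    by move=> da; apply/eqP; apply/negPn/negP => dna; apply: nc; exists d.
  have eb : b = a by apply: single.
  have N1 : class_norm2 (const_mx 1 : 'rV[R]_n) a = 1.
    rewrite /class_norm2 (bigD1 a) //= mxE expr1n big1 ?addr0 // => d.
    by case/andP=> /eqP/single-> /eqP.
  have val : reflection_form u t (const_mx 1) = - (u a * t a).
    have off a' b' : sg a' = sg b' -> a' != a -> u a' * t b' = 0.
      move=> s ne; apply/eqP/negPn/negP; rewrite mulf_eq0 negb_or => /andP[h1 h2].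
      by move: ne; rewrite (single a' (only _ _ s h1 h2)) eqxx.
    rewrite reflection_formE (bigD1 a) //= big1 ?addr0; last by move=> d dn; rewrite off.
    rewrite (bigD1 a) //= (bigD1 a) //= N1 !mxE big1 ?addr0; last first.
      by move=> d /andP[/eqP/single-> /eqP].
    rewrite big1 ?addr0; last first.
      by move=> d dn; rewrite big1 // => d' /eqP e; rewrite off // !mul0r.
    by rewrite !mulr1 divr1; ring.
  by rewrite val oppr_eq0 mulf_neq0 // -eb.
(* The value 1 off the class of [a] keeps all other norms nonzero. *)
pose ext (x : 'I_n -> R) : 'rV[R]_n := \row_d if sg d == sg a then x d else 1.
have extN x d0 : sg d0 = sg a -> x d0 != 0 -> forall d, class_norm2 (ext x) d != 0.
  move=> sd xd d; case: (sg d =P sg a) => da.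
    by apply: (@class_norm2_neq0 _ _ d0); rewrite ?mxE sd ?da ?eqxx.
  by apply: (@class_norm2_neq0 _ _ d); rewrite ?mxE // (introF eqP da) oner_eq0.
pose lin (u : 'I_n -> R) x := \sum_(d | sg d == sg a) u d * x d.
have [E hE] : exists E, forall x, reflection_form u t (ext x) =
    E - 2%:R * (lin u x * lin t x / class_norm2 (ext x) a).
  exists (\sum_a u a * t a - 2%:R * \sum_(d | sg d != sg a) \sum_(b | sg b == sg d)
     u d * t b / class_norm2 (const_mx 1 : 'rV[R]_n) d) => x.
  rewrite reflection_formE [X in _ - _ * X](bigID (fun d => sg d == sg a)) /=.
  set s1 := \sum_(i | sg i == _) _; set s2 := \sum_(i | sg i != _) _.
  have -> : s1 = lin u x * lin t x / class_norm2 (ext x) a.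
    rewrite /s1 {1}/lin !mulr_suml; apply: eq_bigr => d /eqP sd.
    rewrite /lin mulr_sumr mulr_suml sd; apply: eq_bigr => d' sd'.
    by rewrite !mxE sd eqxx sd' (eq_class_norm2 _ sd); ring.
  have -> : s2 = \sum_(d | sg d != sg a) \sum_(b | sg b == sg d)
     u d * t b / class_norm2 (const_mx 1 : 'rV[R]_n) d.
    rewrite /s2; apply: eq_bigr => d dn; apply: eq_bigr => d' /eqP sd'.
    rewrite !mxE sd' (negPf dn); congr (_ / _); first by rewrite !mulr1.
    by apply: eq_bigr => e /eqP se; rewrite !mxE se (negPf dn).
  by ring.
(* A nonzero vector orthogonal to [u] on the class, supported on [a] and [c]; there the form equals
   [E]. *)
pose x0 d := if d == a then u c else if d == c then - u a else 0.
have lin0 : lin u x0 = 0.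
  rewrite /lin (bigD1 a) //= (bigD1 c) ?sca ?eqxx ?ca //= big1 ?addr0.
    by rewrite /x0 !eqxx (negPf ca); ring.
  by move=> d /andP[/andP[_ /negPf da] /negPf dc]; rewrite /x0 da dc mulr0.
have x0c : x0 c != 0 by rewrite /x0 eqxx (negPf ca) oppr_eq0.
(* The unit vector at [a] serves if t_a is nonzero, the one at [b] if u_b is nonzero, and otherwise
   their sum. *)
have [x1 [d0 sd0 x1d0] lin1] : exists2 x1, (exists2 d0, sg d0 = sg a & x1 d0 != 0) &
    lin u x1 * lin t x1 != 0.
  pose de (e : 'I_n) (d : 'I_n) : R := (d == e)%:R.
  have linde v e : sg e = sg a -> lin v (de e) = v e.
    move=> se; rewrite /lin (bigD1 e) ?se //= /de eqxx mulr1 big1 ?addr0 //.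
    by move=> d /andP[_ /negPf->]; rewrite mulr0.
  have [ta|ta] := eqVneq (t a) 0; last first.
    exists (de a); first by exists a; rewrite // /de eqxx oner_eq0.
    by rewrite !linde // mulf_neq0.
  have [ub|ub] := eqVneq (u b) 0; last first.
    exists (de b); first by exists b; rewrite // /de eqxx oner_eq0.
    by rewrite !linde // mulf_neq0.
  have linD v : lin v (fun d => de a d + de b d) = v a + v b.
    rewrite -(linde v a) // -(linde v b) // -big_split.
    by apply: eq_bigr => d _; rewrite mulrDr.
  exists (fun d => de a d + de b d); last first.
    by rewrite !linD ta ub addr0 add0r mulf_neq0.
  exists a => //; rewrite /de eqxx.
  have /negPf-> : a != b by apply: contraNneq ua => ->; rewrite ub.
  by rewrite addr0 oner_eq0.
have [f0|] := eqVneq (reflection_form u t (ext x0)) 0; last first.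
  by exists (ext x0) => //; apply: extN x0c.
exists (ext x1); first exact: extN x1d0.
move: f0; rewrite !hE lin0 !mul0r mulr0 subr0 => ->; rewrite sub0r oppr_eq0.
have [lu lt] : lin u x1 != 0 /\ lin t x1 != 0.
  by move: lin1; rewrite mulf_eq0 negb_or => /andP[].
by rewrite !mulf_neq0 ?pnatr_eq0 ?invr_eq0 //; apply: (extN _ d0).
Qed.

Lemma generic_reflection (J : finType) (P : pred J) (u t : J -> 'I_n -> R) :
  (forall j, P j -> transverse (u j) (t j)) ->
  exists w, forall j, P j -> reflection_form (u j) (t j) w != 0.
Proof.
move=> tr.
(* The extra condition [None] keeps all norms nonzero, so that clearing denominators can be undone
   at the generic point. *)
pose F (o : option J) w := if o is Some j then cleared_form (u j) (t j) w
                           else \prod_c class_norm2 w c.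
have [|o|w hw] := @generic_point R n (option J)
    (None :: [seq Some j | j <- enum P]) F.
- case=> [j|] /=; first exact: poly_cleared_form.
  by apply: poly_on_lines_prod; apply: poly_class_norm2.
- rewrite inE => /predU1P[->|/mapP[j]].
    exists (const_mx 1); apply/prodf_neq0 => d _.
    by apply: (@class_norm2_neq0 _ _ d); rewrite // mxE oner_eq0.
  rewrite mem_enum => /tr/transverse_witness[w N0 f0] ->; exists w.
  by rewrite /= cleared_formE // mulf_neq0 //; apply/prodf_neq0 => d _.
exists w => j Pj.
have N0 a : class_norm2 w a != 0.
  by have /prodf_neq0/(_ a isT) := hw None (mem_head _ _).
have js : Some j \in None :: [seq Some j | j <- enum P].
  by rewrite inE /= mem_map ?mem_enum // => ? ? [].
by have := hw _ js; rewrite /= cleared_formE // mulf_eq0 negb_or => /andP[].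
Qed.

End Reflection.

(** * Couplings of eigenspaces *)

Section Coupling.

Variables (R : rcfType) (I : eqType) (lam : I -> R).

Definition eigen_diag n (sg : 'I_n -> I) : 'M[R]_n :=
  diag_mx (\row_a lam (sg a)).

Lemma eigen_diag_tr n (sg : 'I_n -> I) : (eigen_diag sg)^T = eigen_diag sg.
Proof. exact: tr_diag_mx. Qed.

(* M restricts, for each s with |lam s| < 1, to sqrt (1 - lam s ^ 2) times an
   orthogonal map between the classes of s, and vanishes on the others. *)
Definition coupling n n' (sg : 'I_n -> I) (tg : 'I_n' -> I) (M : 'M[R]_(n, n')) :=
  [/\ M *m M^T = 1%:M - eigen_diag sg *m eigen_diag sg,
      M^T *m M = 1%:M - eigen_diag tg *m eigen_diag tg &
      eigen_diag sg *m M = M *m eigen_diag tg].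

Lemma coupling_tr n n' (sg : 'I_n -> I) (tg : 'I_n' -> I) M :
  coupling sg tg M -> coupling tg sg M^T.
Proof.
case=> h1 h2 h3; split; rewrite ?trmxK //.
by apply: trmx_inj; rewrite !trmx_mul !trmxK !eigen_diag_tr h3.
Qed.

Variables (n n' : nat) (sg : 'I_n -> I) (tg : 'I_n' -> I).

(** Classes of equal size are matched by position in their enumerations; [a0] is only the default of
    [nth]. *)
Lemma class_matching (D : pred I) (a0 : 'I_n) :
  (forall s, D s -> #|[pred a | sg a == s]| = #|[pred b | tg b == s]|) ->
  exists th : 'I_n' -> 'I_n,
    [/\ forall b, D (tg b) -> sg (th b) = tg b,
        forall b b', D (tg b) -> D (tg b') -> th b = th b' -> b = b' &
        forall a, D (sg a) -> exists2 b, tg b = sg a & th b = a].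
Proof.
move=> hc.
pose cG s := enum [pred a | sg a == s]; pose cH s := enum [pred b | tg b == s].
have sz s : D s -> size (cG s) = size (cH s) by rewrite -!cardE; apply: hc.
pose th b := nth a0 (cG (tg b)) (index b (cH (tg b))).
have bin b : b \in cH (tg b) by rewrite mem_enum inE.
have ain a : a \in cG (sg a) by rewrite mem_enum inE.
have thE b : D (tg b) -> sg (th b) = tg b.
  move=> Db; have : th b \in cG (tg b) by rewrite mem_nth // sz // index_mem.
  by rewrite mem_enum inE => /eqP.
exists th; split=> // [b b' Db Db' e|a Da].
  have et : tg b = tg b' by rewrite -thE // -[RHS]thE // e.
  move/eqP: e; rewrite /th -et nth_uniq ?enum_uniq ?sz ?index_mem //; last by rewrite et.
  move/eqP => e; rewrite -(nth_index b (bin b)) e nth_index // et //.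
(* A default for [nth]: the class of [a] is nonempty for [sg], hence for [tg]. *)
have b0 : 'I_n'.
  have : (0 < #|[pred b | tg b == sg a]|)%N.
    by rewrite -hc //; apply/card_gt0P; exists a; rewrite inE.
  by case: n' tg => [tg0|m _ _]; [rewrite eq_card0 // => -[] | exact: ord0].
have lt : (index a (cG (sg a)) < size (cH (sg a)))%N by rewrite -sz // index_mem.
pose b := nth b0 (cH (sg a)) (index a (cG (sg a))).
have tb : tg b = sg a.
  by have := mem_nth b0 lt; rewrite mem_enum inE => /eqP.
by exists b; rewrite // /th tb index_uniq ?enum_uniq // nth_index.
Qed.

Lemma class_reflection_comm w :
  eigen_diag sg *m class_reflection sg w = class_reflection sg w *m eigen_diag sg.
Proof.
apply/matrixP => a b; rewrite mul_diag_mx mul_mx_diag !mxE.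
have [->|ab] := eqVneq a b; first by rewrite mulrC.
by case: eqP => [->|_]; [rewrite mulrC | rewrite mulr0 subr0 mulr0 mul0r].
Qed.

Hypothesis lam_le1 : forall s, lam s ^+ 2 <= 1.
Hypothesis card_classes : forall s, lam s ^+ 2 < 1 ->
  #|[pred a | sg a == s]| = #|[pred b | tg b == s]|.

Let c s := Num.sqrt (1 - lam s ^+ 2).

Let c_sq s : c s ^+ 2 = 1 - lam s ^+ 2.
Proof. by rewrite sqr_sqrtr // subr_ge0. Qed.

Let c_eq0 s : (c s == 0) = ~~ (lam s ^+ 2 < 1).
Proof.
by rewrite sqrtr_eq0 subr_le0 real_ltNge ?num_real // negbK.
Qed.

(** A weighted partial permutation matrix. The weight is 0 where |lam| = 1, so the values of [th]
    there do not matter. *)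
Definition base_coupling (th : 'I_n' -> 'I_n) : 'M[R]_(n, n') :=
  \matrix_(a, b) (c (tg b) * (a == th b)%:R).

Lemma base_couplingP th :
    (forall b, lam (tg b) ^+ 2 < 1 -> sg (th b) = tg b) ->
    (forall b b', lam (tg b) ^+ 2 < 1 -> lam (tg b') ^+ 2 < 1 ->
      th b = th b' -> b = b') ->
    (forall a, lam (sg a) ^+ 2 < 1 -> exists2 b, tg b = sg a & th b = a) ->
  coupling sg tg (base_coupling th).
Proof.
move=> thE th_inj th_surj.
have zero b : ~~ (lam (tg b) ^+ 2 < 1) -> c (tg b) = 0.
  by move=> h; apply/eqP; rewrite c_eq0.
split; apply/matrixP.
- move=> a a'; rewrite mul_diag_mx !mxE.
  under eq_bigr do rewrite !mxE.
  have [<-{a'}|ne] := eqVneq a a'; last first.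
    rewrite mulr0n mulr0 subr0 big1 // => b _.
    have [eb|_] := eqVneq a (th b); last by rewrite mulr0 mul0r.
    by rewrite -eb eq_sym (negPf ne) !mulr0.
  have [lt|nlt] := boolP (lam (sg a) ^+ 2 < 1).
    have [b tb thb] := th_surj a lt.
    rewrite (bigD1 b) //= thb eqxx !mulr1 tb -expr2 c_sq mulr1n expr2 big1 ?addr0 //.
    move=> b' nb'; have [|nl] := boolP (lam (tg b') ^+ 2 < 1); last by rewrite zero // !mul0r.
    move=> lb'; have [e|_] := eqVneq a (th b'); last by rewrite mulr0 mul0r.
    by case/eqP: nb'; apply: th_inj; rewrite ?tb // thb.
  (* Squares are at most 1, so here the square is exactly 1 and row [a] must vanish. *)
  have -> : lam (sg a) * (lam (sg a) *+ 1) = 1.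
    by apply/eqP; rewrite mulr1n eq_le -expr2 lam_le1 real_leNgt ?num_real.
  rewrite mulr1n subrr big1 // => b _.
  have [lb|nl] := boolP (lam (tg b) ^+ 2 < 1); last by rewrite zero // !mul0r.
  have [e|_] := eqVneq a (th b); last by rewrite mulr0 mul0r.
  by case/negP: nlt; rewrite e thE.
- move=> b b'; rewrite mul_diag_mx !mxE.
  under eq_bigr do rewrite !mxE.
  rewrite (bigD1 (th b)) //= eqxx big1 ?addr0; last first.
    by move=> a /negPf->; rewrite mulr0 mul0r.
  have [<-{b'}|ne] := eqVneq b b'; first by rewrite eqxx !mulr1 -expr2 c_sq mulr1n expr2.
  rewrite mulr0n mulr0 subr0 mulr1.
  have [e|_] := eqVneq; last by rewrite !mulr0.
  have [lb|nl] := boolP (lam (tg b) ^+ 2 < 1); last by rewrite zero // !mul0r.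
  have [lb'|nl] := boolP (lam (tg b') ^+ 2 < 1); last by rewrite (zero b') // mul0r mulr0.
  by case/eqP: ne; apply: th_inj.
- move=> a b; rewrite mul_diag_mx mul_mx_diag !mxE.
  have [lb|nl] := boolP (lam (tg b) ^+ 2 < 1); last by rewrite zero // !mul0r mulr0.
  by have [->|_] := eqVneq; rewrite ?thE ?mulr0 ?mul0r ?mulr0 // mulrC.
Qed.

(** The reflection is a symmetric involution that commutes with the diagonal matrix, so it cancels
    from all three identities. *)
Lemma coupling_reflection w M :
  coupling sg tg M -> coupling sg tg (class_reflection sg w *m M).
Proof.
have K2 := class_reflection_sq sg w; have KC := class_reflection_comm w.
have KT := class_reflection_tr sg w.
move: (class_reflection sg w) K2 KC KT => K K2 KC KT; case=> h1 h2 h3; split; rewrite ?trmx_mul ?KT.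
- rewrite mulmxA -(mulmxA _ M) h1 mulmxBr mulmx1 mulmxBl K2; congr (_ - _).
  by rewrite -!mulmxA KC !mulmxA -KC -(mulmxA _ K K) K2 mulmx1.
- rewrite !mulmxA -(mulmxA M^T) K2 mulmx1 //.
- by rewrite mulmxA KC -!mulmxA h3.
Qed.

Definition coupling_form (u : 'I_n -> R) (t : 'I_n' -> R) (M : 'M[R]_(n, n')) : R :=
  \sum_a \sum_b u a * M a b * t b.

(** The analogue of [transverse] for two index sets, restricted to the classes with |lam| < 1 on
    which a coupling is nonzero. *)
Definition couplable (u : 'I_n -> R) (t : 'I_n' -> R) : Prop :=
  exists a b, [/\ sg a = tg b, lam (sg a) ^+ 2 < 1, u a != 0, t b != 0 &
    (exists2 e, e != a & sg e = sg a) \/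
    (forall a' b', sg a' = tg b' -> lam (sg a') ^+ 2 < 1 ->
       u a' != 0 -> t b' != 0 -> sg a' = sg a)].

Lemma generic_coupling (J : finType) (P : pred J)
    (u : J -> 'I_n -> R) (t : J -> 'I_n' -> R) (a0 : 'I_n) :
  (forall j, P j -> couplable (u j) (t j)) ->
  exists2 M, coupling sg tg M & forall j, P j -> coupling_form (u j) (t j) M != 0.
Proof.
move=> hP.
have [th [thE th_inj th_surj]] := class_matching a0 card_classes.
(* The image of [t j] under [base_coupling th]; with it the coupling form of reflection times base
   coupling becomes a [reflection_form]. *)
pose t' j a := \sum_(b | th b == a) c (tg b) * t j b.
have formE j w : coupling_form (u j) (t j) (class_reflection sg w *m base_coupling th)
    = reflection_form sg (u j) (t' j) w.
  apply: eq_bigr => a _; rewrite (partition_big th xpredT) //=.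
  apply: eq_bigr => z _; rewrite mulr_sumr; apply: eq_bigr => b /eqP tb.
  rewrite [X in _ * X * _]mxE (bigD1 z) //= big1 ?addr0; last first.
    by move=> z' /negPf nz; rewrite !mxE tb nz !mulr0.
  by rewrite [base_coupling _ _ _]mxE tb eqxx mulr1; ring.
have t'_th j b : lam (tg b) ^+ 2 < 1 -> t' j (th b) = c (tg b) * t j b.
  move=> lb; rewrite /t' (bigD1 b) //= big1 ?addr0 // => b' /andP[/eqP e /eqP ne].
  have [lb'|nl] := boolP (lam (tg b') ^+ 2 < 1); first by case: ne; apply: th_inj.
  by rewrite (eqP (_ : c (tg b') == 0)) ?mul0r // c_eq0.
have t'_neq0 j a : t' j a != 0 ->
    exists b, [/\ th b = a, lam (tg b) ^+ 2 < 1 & t j b != 0].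
  move=> ta; apply: contrapT => nb; move/eqP: ta; apply.
  apply: big1 => b /eqP thb; apply/eqP; rewrite mulf_eq0 c_eq0.
  by apply: contrapT => /negP; rewrite negb_or negbK => /andP[h1 h2]; apply: nb; exists b.
have [j Pj|w hw] := @generic_reflection R n I sg J P u t'.
  have [a [b [ab la ua tb alt]]] := hP j Pj.
  have lb : lam (tg b) ^+ 2 < 1 by rewrite -ab.
  exists a, (th b); split=> //; first by rewrite thE.
    by rewrite t'_th // mulf_neq0 // c_eq0 lb.
  case: alt => [|only]; [by left | right=> a' z sz ua' /t'_neq0[b' [thb' lb' tb']]].
  have sz' : sg a' = tg b' by rewrite sz -thb' thE.
  by apply: (only a' b'); rewrite // sz'.
exists (class_reflection sg w *m base_coupling th).
  by apply: coupling_reflection; apply: base_couplingP.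
by move=> j Pj; rewrite formE hw.
Qed.

End Coupling.

(** * Matrices of joins *)

Section JoinRealisation.

Variable R : realType.

Lemma n_eigenvalues_involution n (X : 'M[R]_n) :
  X *m X = 1%:M -> (n_eigenvalues X <= 2)%N.
Proof.
move=> X2.
have sub : ([set a : R | eigenvalue X a] `<=` [set` [fset 1%R; (-1)%R]%fset])%classic.
  move=> a /= /eigenvalueP[v vX v0].
  have : (a ^+ 2 - 1) *: v = 0.
    rewrite scalerBl scale1r expr2 -scalerA -vX scalemxAl -vX -mulmxA X2 mulmx1.
    by rewrite subrr.
  move/eqP; rewrite scaler_eq0 (negPf v0) orbF subr_eq0 sqrf_eq1.
  by rewrite /= !inE.
rewrite /n_eigenvalues; apply: leq_trans (_ : #|` [fset 1%R; (-1)%R : R]|%fset <= 2)%N; last first.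
  by rewrite cardfs2; case: (_ != _).
apply: fsubset_leq_card.
by rewrite -[X in (_ `<=` X)%fset]set_fsetK -fset_set_sub //; apply: finite_subfset sub.
Qed.

(** The product identities are the blocks of X^2 = 1, the lower left one by transposition; the sign
    in front of [C] does not affect the pattern. *)
Lemma q_join_le2 (G H : sgraph) n n' (gv : 'I_n -> G) (hv : 'I_n' -> H)
    (A : 'M[R]_n) (B : 'M[R]_(n, n')) (C : 'M[R]_n') :
  bijective gv -> bijective hv ->
  A^T = A -> C^T = C ->
  (forall i j, i != j -> (A i j != 0) = adj (gv i) (gv j)) ->
  (forall i j, i != j -> (C i j != 0) = adj (hv i) (hv j)) ->
  nowhere_zero B ->
  A *m A + B *m B^T = 1%:M -> B^T *m B + C *m C = 1%:M -> A *m B = B *m C ->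
  (q R (join G H) <= 2)%N.
Proof.
case=> gi gvK giK [hi hvK hiK] AT CT Aadj Cadj B0 AA CC AB.
pose X := block_mx A B B^T (- C).
pose f (v : join G H) : 'I_(n + n') :=
  match v with inl a => lshift n' (gi a) | inr b => rshift n (hi b) end.
pose g (x : 'I_(n + n')) : join G H :=
  match split x with inl a => inl (gv a) | inr b => inr (hv b) end.
have fK : cancel f g.
  by case=> v; rewrite /f /g ?(unsplitK (inl _)) ?(unsplitK (inr _)) ?giK ?hiK.
have gK : cancel g f.
  by move=> x; rewrite /f /g; case: split_ordP => y ->; rewrite ?gvK ?hvK.
(* [in_S] orders vertices by [enum_val], whereas [X] lists those of [G] before those of [H]; [h]
   translates. *)
pose h (i : 'I_#|join G H|) := f (enum_val i).
have hbij : bijective h.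
  exists (enum_rank \o g) => x /=; rewrite /h ?fK ?enum_valK //=.
  by rewrite enum_rankK gK.
pose Y := mxsub h h X.
have X2 : X *m X = 1%:M.
  have BA : B^T *m A = C *m B^T by rewrite -{1}AT -trmx_mul AB trmx_mul CT.
  by rewrite mulmx_block !mulNmx !mulmxN opprK AA AB BA CC !subrr -scalar_mx_block.
have Y2 : Y *m Y = 1%:M.
  apply/matrixP => i j; rewrite !mxE.
  transitivity ((X *m X) (h i) (h j)).
    rewrite mxE [RHS](reindex h) /=; last exact: onW_bij.
    by apply: eq_bigr => e _; rewrite !mxE.
  by rewrite X2 mxE (inj_eq (bij_inj hbij)).
have YS : in_S Y.
  split.
    by rewrite trmx_mxsub /X tr_block_mx trmxK AT linearN /= CT.
  move=> i j ij; have : h i != h j by rewrite (inj_eq (bij_inj hbij)).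
  rewrite [Y i j]mxE /h /X; case: (enum_val i) => x; case: (enum_val j) => y /= ne.
  - by rewrite block_mxEul Aadj ?giK //; apply: contraNneq ne => ->.
  - by rewrite block_mxEur B0.
  - by rewrite block_mxEdl mxE B0.
  - by rewrite block_mxEdr mxE oppr_eq0 Cadj ?hiK //; apply: contraNneq ne => ->.
rewrite /q; case: ex_minnP => d _ min.
apply: leq_trans (min (n_eigenvalues Y) _) (n_eigenvalues_involution Y2).
by apply/asboolP; exists Y.
Qed.

(** With A = Phi L Phi^T, B = Phi M Psi^T and C = Psi L' Psi^T, the inner orthogonal factors cancel
    and the identities reduce to those of a coupling. *)
Lemma q_join_le2_coupling (I : eqType) (lam : I -> R) (G H : sgraph) n n'
    (gv : 'I_n -> G) (hv : 'I_n' -> H) (sg : 'I_n -> I) (tg : 'I_n' -> I)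
    (Phi : 'M[R]_n) (Psi : 'M[R]_n') (M : 'M[R]_(n, n')) :
  bijective gv -> bijective hv -> orthogonal_mx Phi -> orthogonal_mx Psi ->
  (forall i j, i != j ->
    ((Phi *m eigen_diag lam sg *m Phi^T) i j != 0) = adj (gv i) (gv j)) ->
  (forall i j, i != j ->
    ((Psi *m eigen_diag lam tg *m Psi^T) i j != 0) = adj (hv i) (hv j)) ->
  coupling lam sg tg M -> nowhere_zero (Phi *m M *m Psi^T) ->
  (q R (join G H) <= 2)%N.
Proof.
move=> gb hb oP oQ Aadj Cadj [h1 h2 h3] B0.
have oP' : Phi^T *m Phi = 1%:M by apply: mulmx1C.
have oQ' : Psi^T *m Psi = 1%:M by apply: mulmx1C.
have sandwich p r s t (S : 'M[R]_(t, p)) (T : 'M[R]_p) (Z : 'M[R]_(p, r)) (W : 'M[R]_(r, s)) :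
    T^T *m T = 1%:M -> (S *m T^T) *m (T *m Z *m W) = S *m Z *m W.
  by move=> o; rewrite !mulmxA -(mulmxA S) o mulmx1.
apply: (q_join_le2 gb hb _ _ Aadj Cadj B0).
- by rewrite !trmx_mul trmxK eigen_diag_tr mulmxA.
- by rewrite !trmx_mul trmxK eigen_diag_tr mulmxA.
- rewrite !trmx_mul trmxK (mulmxA Psi) !sandwich // -mulmxDl -!(mulmxA Phi) -mulmxDr.
  by rewrite h1 addrC subrK mulmx1.
- rewrite !trmx_mul trmxK (mulmxA Psi) !sandwich // -mulmxDl -!(mulmxA Psi) -mulmxDr.
  by rewrite h2 subrK mulmx1.
- by rewrite !sandwich // -(mulmxA Phi) h3 !mulmxA.
Qed.

End JoinRealisation.

(** * Block diagonal realisations *)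

Import tagnat.

Lemma Rank_inj (n : nat) (p_ : 'I_n -> nat) i : injective (@Rank n p_ i).
Proof. by move=> x y /rank_inj/eqP; rewrite eq_Tagged => /eqP. Qed.

Lemma mxdiagM (R : pzSemiRingType) (n : nat) (p_ : 'I_n -> nat)
    (A B : forall i, 'M[R]_(p_ i)) :
  (\mxdiag_i A i) *m (\mxdiag_i B i) = \mxdiag_i (A i *m B i).
Proof.
rewrite {1}/mxdiag mul_mxblock_mxdiag; apply: eq_mxblock => i j.
by case: eqVneq => [->|_]; rewrite ?mul0mx // !conform_mx_id.
Qed.

(** The class of a diagonal position is the index of its block. It is fixed before [lam], so the
    same classes serve every spectrum. *)
Lemma D_mx_diag (R : realType) (r n : nat) (v : 'cV[nat]_r) : (\sum_i v i ord0)%N = n ->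
  exists2 s : 'I_n -> 'I_r, forall e, #|[pred j | s j == e]| = v e ord0 &
    forall lam : 'I_r -> R, D_mx n lam v = eigen_diag lam s.
Proof.
move=> <-; exists (@sig1 r (fun i => v i ord0)) => [e|lam].
  rewrite -[RHS]card_ord -(fintype.card_image (@Rank_inj r (fun i => v i ord0) e)).
  apply: eq_card => j; rewrite !inE; apply/eqP/fintype.imageP => [<-|[x _ ->]].
    by exists (sig2 j); rewrite ?sig2K.
  exact: Rank1K.
rewrite /D_mx conform_mx_id /eigen_diag.
transitivity (\mxdiag_(i < r) diag_mx (const_mx (lam i) : 'rV_(v i ord0))).
  by apply: eq_mxdiag => i; rewrite diag_const_mx.
by rewrite -diag_mxrow; congr diag_mx; apply/rowP => j; rewrite !mxE.
Qed.

Section Components.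

Variables (G : sgraph) (k : nat) (C : 'I_k -> {set G}).
Hypothesis compG : lists_components C.

Lemma components_partition : finset.partition (components G) [set: G].
Proof.
apply: equivalence_partitionP => x y z _ _ _; split; first exact: connect0.
by move=> xy; apply: (same_connect _ xy); apply: sym_connect_sym; apply: adj_sym.
Qed.

Lemma component_cover x : exists i, x \in C i.
Proof.
have [_ eC] := compG; have /and3P[/eqP cov _ _] := components_partition.
have : x \in finset.cover (components G) by rewrite cov inE.
by case/bigcupP => A; rewrite -eC => /imsetP[i _ ->]; exists i.
Qed.

Lemma component_uniq x i j : x \in C i -> x \in C j -> i = j.
Proof.
have [Cinj eC] := compG; have /and3P[_ /finset.trivIsetP triv _] := components_partition.
move=> xi xj; apply/Cinj/eqP; apply: contraT => ne.
have /pred0P/(_ x) : [disjoint C i & C j].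
  by apply: triv; rewrite // -eC; apply/imsetP; [exists i | exists j].
by rewrite /= xi xj.
Qed.

Lemma adj_component x y i : adj x y -> x \in C i -> y \in C i.
Proof.
move=> xy xi; have [_ eC] := compG.
have : C i \in components G by rewrite -eC; apply/imsetP; exists i.
case/imsetP => z _ e; move: xi; rewrite e !inE /= => zx.
exact: connect_trans zx (connect1 xy).
Qed.

Local Notation size_ i := #|induced (C i)|.
Local Notation N := (\sum_i size_ i)%N.

(* The vertices of G are numbered component by component. *)
Definition comp_vertex (a : 'I_N) : G := val (enum_val (sig2 a)).

Lemma comp_vertex_rank p : comp_vertex (rank p) = val (enum_val (tagged p)).
Proof. by rewrite /comp_vertex /sig2 /sig1 rankK. Qed.

Lemma comp_vertex_inj : injective comp_vertex.
Proof.
move=> a b; rewrite -[a]sigK -[b]sigK !comp_vertex_rank.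
case: (sig a) (sig b) => [i x] [j y] /= e.
have ij : i = j.
  apply: (@component_uniq (sval (enum_val x))); first exact: svalP (enum_val x).
  by rewrite e; exact: svalP (enum_val y).
by case: _ / ij y e => y /val_inj/enum_val_inj->.
Qed.

Lemma comp_vertex_bij : bijective comp_vertex.
Proof.
pose g x := rank (Tagged (fun i => 'I_(size_ i))
  (enum_rank (Sub x (svalP (cid (component_cover x))) : induced (C _)))).
have gK : cancel g comp_vertex.
  by move=> x; rewrite comp_vertex_rank /= enum_rankK.
by exists g => //; apply: inj_can_sym gK comp_vertex_inj.
Qed.

Section Classes.

Variables (R : realType) (r : nat) (V : 'M[nat]_(r, k)).

(* sg a is the row of V whose eigenvalue stands at the a-th diagonal place of
   the direct sum of the matrices D_{lam, v_i}. *)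
Definition row_classes (sg : 'I_N -> 'I_r) : Prop :=
  (forall i s, #|[pred a | (sig1 a == i) && (sg a == s)]| = V s i) /\
  (forall (lam : 'I_r -> R) i,
     D_mx (size_ i) lam (col i V) = eigen_diag lam (sg \o Rank i)).

Lemma row_classes_exist : mult_matrix R C V -> exists sg, row_classes sg.
Proof.
move=> mV.
have ex i := D_mx_diag R (proj1 (mV i)).
pose sgi i := s2val (cid2 (ex i)).
have [sgi_card sgi_D] : (forall i e, #|[pred j | sgi i j == e]| = V e i) /\
    (forall i (lam : 'I_r -> R), D_mx (size_ i) lam (col i V) = eigen_diag lam (sgi i)).
  split=> [i e|i lam]; last exact: s2valP' (cid2 (ex i)) lam.
  by rewrite (s2valP (cid2 (ex i)) e) mxE.
pose sg (a : 'I_N) := sgi (sig1 a) (sig2 a).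
have sgR i x : sg (Rank i x) = sgi i x by rewrite /sg /sig2 /sig1 rankK.
exists sg; split=> [i s|lam i]; last first.
  by rewrite sgi_D; congr diag_mx; apply/rowP => x; rewrite !mxE /= sgR.
rewrite -sgi_card -(fintype.card_image (@Rank_inj k (fun i => size_ i) i)).
apply: eq_card => j; rewrite !inE; apply/andP/fintype.imageP => [[/eqP<- /eqP<-]|[x]].
  by exists (sig2 j); rewrite ?sig2K // inE.
by rewrite inE => /eqP<- ->; rewrite sgR Rank1K !eqxx.
Qed.

Variables (sg : 'I_N -> 'I_r) (lam : 'I_r -> R).
Hypothesis classes : row_classes sg.

(** The middle clause encodes block diagonality over the components with nowhere-zero blocks. *)
Definition realises (Phi : 'M[R]_N) : Prop :=
  [/\ orthogonal_mx Phi, forall a b, (Phi a b != 0) = (sig1 a == sig1 b) &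
      forall a b, a != b -> ((Phi *m eigen_diag lam sg *m Phi^T) a b != 0) =
                           adj (comp_vertex a) (comp_vertex b)].

Lemma mxdiagE (U : forall i, 'M[R]_(size_ i)) p q :
  (\mxdiag_i U i) (rank p) (rank q) =
  if tag p == tag q then U (tag p) (tagged p) (tagged_as p q) else 0.
Proof.
rewrite !mxE /sig2 /sig1 !rankK; case: p q => [i x] [j y] /=.
case: eqP => [ij|_]; last by rewrite mxE.
by case: _ / ij y => y; rewrite tagged_asE conform_mx_id.
Qed.

(** Vertices of different components are not adjacent, which agrees with the zero off-diagonal
    blocks. *)
Lemma mxdiag_realises (U : forall i, 'M[R]_(size_ i)) :
  (forall i, orthogonal_mx (U i)) -> (forall i, nowhere_zero (U i)) ->
  (forall i, in_S (U i *m D_mx (size_ i) lam (col i V) *m (U i)^T)) ->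
  realises (\mxdiag_i U i).
Proof.
move=> oU nzU SU; have [_ sgD] := classes; split.
- by rewrite /orthogonal_mx tr_mxdiag mxdiagM -(mxdiagZ 1); apply: eq_mxdiag.
- move=> a b; rewrite -[a]sigK -[b]sigK mxdiagE /sig1 !rankK.
  by case: ifP => _; [apply: nzU | rewrite eqxx].
have diagE : eigen_diag lam sg = \mxdiag_i eigen_diag lam (sg \o Rank i).
  by rewrite -diag_mxrow; congr diag_mx; apply/rowP => a; rewrite !mxE /= sig2K.
have prodE : (\mxdiag_i U i) *m eigen_diag lam sg *m (\mxdiag_i U i)^T =
    \mxdiag_i (U i *m D_mx (size_ i) lam (col i V) *m (U i)^T).
  by rewrite diagE tr_mxdiag !mxdiagM; apply: eq_mxdiag => i; rewrite sgD.
move=> a b; rewrite prodE -[a]sigK -[b]sigK (inj_eq rank_inj) mxdiagE !comp_vertex_rank.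
case: (sig a) (sig b) => [i x] [j y] /=.
case: (i =P j) => [ij|ij].
  case: _ / ij y => y; rewrite tagged_asE eq_Tagged => xy.
  by have [_ /(_ x y xy)] := SU i.
move=> _; rewrite eqxx; apply/esym/negbTE/negP => /adj_component h.
by apply: ij; apply: (@component_uniq (val (enum_val y))); [apply: h; exact: svalP (enum_val x) | exact: svalP (enum_val y)].
Qed.

Hypothesis lam_incr : increasing lam.

Lemma sane_realises : sane_matrix R C V -> exists Phi, realises Phi.
Proof.
case=> _ sV; have ex i := proj2 (sV i) lam lam_incr.
exists (\mxdiag_i sval (cid (ex i))).
by apply: mxdiag_realises => i; case: cid => U [].
Qed.

(** Block i of Phi y is U_i applied to block i of y, so each component is realised against the
    finite set of the i-th blocks of all [y j]. *)
Lemma gen_realises (J : finType) (y : J -> 'cV[R]_N) :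
  gen_realisable_matrix R C V -> (forall j i, submxcol (y j) i != 0) ->
  exists2 Phi, realises Phi & forall j, nowhere_zero (Phi *m y j).
Proof.
case=> _ gV y0.
pose Y i := [fset submxcol (y j) i | j in J]%fset.
have Y0 i : 0 \notin Y i.
  by apply/imfsetP => -[j _ e]; have := y0 j i; rewrite -e eqxx.
have ex i := proj2 (gV i) lam lam_incr (Y i) (Y0 i).
pose U i := sval (cid (ex i)).
exists (\mxdiag_i U i).
  by apply: mxdiag_realises => i; rewrite /U; case: cid => U' [].
move=> j a b; rewrite -[y j]submxcolK mul_mxdiag_mxcol mxE.
rewrite /U; case: cid => U' /= [_ _ _ hU']; apply: hU'.
by apply/imfsetP; exists j.
Qed.

Lemma row_classes_inhab i s : (0 < V s i)%N -> exists2 a, sig1 a = i & sg a = s.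
Proof.
by rewrite -(proj1 classes) => /card_gt0P[a]; rewrite inE => /andP[/eqP<- /eqP<-]; exists a.
Qed.

Lemma row_classes_gt0 a : (0 < V (sg a) (sig1 a))%N.
Proof. by rewrite -(proj1 classes); apply/card_gt0P; exists a; rewrite inE !eqxx. Qed.

Lemma card_row_class s : #|[pred a | sg a == s]| = (\sum_i V s i)%N.
Proof.
rewrite -sum1_card (partition_big (@sig1 _ (fun i => size_ i)) xpredT) //=.
apply: eq_bigr => i _; rewrite -(proj1 classes) -sum1_card.
by apply: eq_bigl => a; rewrite !inE andbC.
Qed.

Lemma two_in_class a : (2 <= \sum_i V (sg a) i)%N -> exists2 c, c != a & sg c = sg a.
Proof.
rewrite -card_row_class (cardD1 a) inE eqxx add1n ltnS => /card_gt0P[c].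
by rewrite !inE => /andP[ca /eqP e]; exists c.
Qed.

End Classes.
End Components.

(** * Choice of the coupling *)

Lemma coupling_form_delta (R : rcfType) n n' (a : 'I_n) (t : 'I_n' -> R) M :
  coupling_form (fun a' => (a == a')%:R) t M = \sum_b M a b * t b.
Proof.
rewrite /coupling_form (bigD1 a) //= [X in _ + X]big1 ?addr0.
  by apply: eq_bigr => b _; rewrite eqxx mul1r.
by move=> a' /negPf ne; apply: big1 => b _; rewrite eq_sym ne !mul0r.
Qed.

Section CoupledRealisations.

Variables (R : realType) (G H : sgraph) (k l r : nat).
Variables (C : 'I_k -> {set G}) (E : 'I_l -> {set H}).
Hypotheses (compG : lists_components C) (compH : lists_components E).
Variables (V : 'M[nat]_(r, k)) (W : 'M[nat]_(r, l)) (lam : 'I_r -> R).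
Hypotheses (lam_incr : increasing lam) (lam_le1 : forall s, lam s ^+ 2 <= 1).
Hypothesis sumsVW : forall s, lam s ^+ 2 < 1 -> (\sum_i V s i = \sum_j W s j)%N.

Local Notation N := (\sum_i #|induced (C i)|)%N.
Local Notation N' := (\sum_j #|induced (E j)|)%N.

Variables (sg : 'I_N -> 'I_r) (tg : 'I_N' -> 'I_r).
Hypotheses (sgV : row_classes R V sg) (tgW : row_classes R W tg).

Let card_classes s : lam s ^+ 2 < 1 ->
  #|[pred a | sg a == s]| = #|[pred b | tg b == s]|.
Proof. by move=> ls; rewrite (card_row_class sgV) (card_row_class tgW) sumsVW. Qed.

Lemma coupling_formE (Phi : 'M[R]_N) (Psi : 'M[R]_N') (M : 'M[R]_(N, N')) x y :
  (Phi *m M *m Psi^T) x y = coupling_form (fun a => Phi x a) (fun b => Psi y b) M.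
Proof.
rewrite mxE /coupling_form exchange_big; apply: eq_bigr => b _ /=.
by rewrite !mxE mulr_suml.
Qed.

Hypothesis G_nonempty : (0 < #|G|)%N.

Let N_gt0 : (0 < N)%N.
Proof. by rewrite -[N]card_ord (bij_eq_card (comp_vertex_bij compG)). Qed.

Let a0 : 'I_N := Ordinal N_gt0.

(** [Phi] and [Psi] are fixed first. A row of [Phi] is supported on exactly one component, so
    whether an entry can be made nonzero depends only on a column of [V] and one of [W]. *)
Lemma coupled_of_sane : sane_matrix R C V -> sane_matrix R E W ->
  (forall i j, exists s, [/\ lam s ^+ 2 < 1, (0 < V s i)%N, (0 < W s j)%N &
     (2 <= \sum_i' V s i')%N \/
     forall s', lam s' ^+ 2 < 1 -> (0 < V s' i)%N -> (0 < W s' j)%N -> s' = s]) ->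
  exists Phi Psi M, [/\ realises sg lam Phi, realises tg lam Psi,
    coupling lam sg tg M & nowhere_zero (Phi *m M *m Psi^T)].
Proof.
move=> sV sW key.
have [Phi rP] := sane_realises compG sgV lam_incr sV.
have [Psi rQ] := sane_realises compH tgW lam_incr sW.
have [_ nzP _] := rP; have [_ nzQ _] := rQ.
have [xy _|M cM nzM] := @generic_coupling R 'I_r lam N N' sg tg lam_le1 card_classes
    ('I_N * 'I_N')%type xpredT (fun xy a => Phi xy.1 a) (fun xy b => Psi xy.2 b) a0.
  have [s [ls Vs Ws alt]] := key (sig1 xy.1) (sig1 xy.2).
  have [a sa ea] := row_classes_inhab sgV Vs.
  have [b sb eb] := row_classes_inhab tgW Ws.
  exists a, b; rewrite nzP nzQ sa sb ea eb !eqxx; split=> //.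
  case: alt => [two|only]; [left | right].
    by move: two; rewrite -ea; apply: (two_in_class sgV).
  move=> a' b' eab la'; rewrite nzP nzQ => /eqP e1 /eqP e2; apply: only => //.
    by rewrite e1; apply: row_classes_gt0 sgV _.
  by rewrite e2 eab; apply: row_classes_gt0 tgW _.
exists Phi, Psi, M; split=> // x y; rewrite coupling_formE.
exact: (nzM (x, y)).
Qed.

(** The order is [Psi], then [M], then [Phi]. Coordinate vectors replace the rows of [Phi], and
    having one-point support they satisfy the uniqueness alternative of [couplable]
    automatically. *)
Lemma coupled_of_gen : gen_realisable_matrix R C V -> sane_matrix R E W ->
  (forall i j, exists s, [/\ lam s ^+ 2 < 1, (0 < V s i)%N & (0 < W s j)%N]) ->
  exists Phi Psi M, [/\ realises sg lam Phi, realises tg lam Psi,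
    coupling lam sg tg M & nowhere_zero (Phi *m M *m Psi^T)].
Proof.
move=> gV sW key.
have [Psi rQ] := sane_realises compH tgW lam_incr sW.
have [_ nzQ _] := rQ.
pose delta (a a' : 'I_N) : R := (a == a')%:R.
(* The predicate selects the entries of M Psi^T that are not forced to be 0. *)
have [ay|M cM nzM] := @generic_coupling R 'I_r lam N N' sg tg lam_le1 card_classes
    ('I_N * 'I_N')%type
    (fun ay => [exists b, [&& Psi ay.2 b != 0, sg ay.1 == tg b & lam (tg b) ^+ 2 < 1]])
    (fun ay => delta ay.1) (fun ay b => Psi ay.2 b) a0.
  move=> /existsP[b /and3P[Qb /eqP sb lb]].
  exists ay.1, b; rewrite sb /delta eqxx oner_eq0; split=> //; right=> a' b' _ _.
  by have [<-|_] := eqVneq ay.1 a'; rewrite ?eqxx.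
pose y h : 'cV[R]_N := col h (M *m Psi^T).
(* A common inner row for [i] and the component of [h] gives an index in component [i] whose pair
   with [h] is selected. *)
have y0 h i : submxcol (y h) i != 0.
  have [s [ls Vs Ws]] := key i (sig1 h).
  have [a sa ea] := row_classes_inhab sgV Vs.
  have [b sb eb] := row_classes_inhab tgW Ws.
  have := nzM (a, h); rewrite /= coupling_form_delta => nz.
  case: _ / sa Vs => Vs.
  apply/eqP => /matrixP/(_ (sig2 a) 0); rewrite !mxE sig2K.
  have -> : \sum_b M a b * Psi^T b h = \sum_b M a b * Psi h b.
    by apply: eq_bigr => b' _; rewrite mxE.
  apply/eqP; apply: nz; apply/existsP; exists b.
  by rewrite nzQ sb ea eb ls !eqxx.
have [Phi rP nzP] := gen_realises compG sgV lam_incr gV y0.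
exists Phi, Psi, M; split=> // x h.
by have := nzP h x 0; rewrite /y colE mulmxA -colE mulmxA mxE.
Qed.

End CoupledRealisations.

(** * The spectrum and the compatibility conditions *)

Section Compatible.

Variables (R : realType) (k l m : nat).

(** The value is s + 1; the nested [lift] mirrors the two row deletions in [inner_rows]. *)
Definition inner_row (s : 'I_m) : 'I_m.+2 := lift ord0 (lift ord_max s).

Lemma inner_rowsE n (X : 'M[nat]_(m.+2, n)) s i : inner_rows X s i = X (inner_row s) i.
Proof. by rewrite !mxE. Qed.

Lemma inner_sumsE n (X : 'M[nat]_(m.+2, n)) s :
  inner_sums X s ord0 = (\sum_i X (inner_row s) i)%N.
Proof. by rewrite !mxE; apply: eq_bigr => i _; rewrite inner_rowsE mxE mulr1. Qed.

(** Equally spaced points from -1 to 1, so that exactly the first and last rows have |lam| = 1. *)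
Definition spectrum (s : 'I_m.+2) : R := s%:R *+ 2 / m.+1%:R - 1.

Lemma spectrum_incr : increasing spectrum.
Proof.
by move=> i j ij; rewrite ltrD2r ltr_pM2r ?invr_gt0 ?ltr0n // ltr_pMn2r // ltr_nat.
Qed.

(** This factorisation reduces comparisons with 1 to the natural number s (m + 1 - s). *)
Lemma spectrum_sq s : 1 - spectrum s ^+ 2 = 4%:R * (s * (m.+1 - s))%:R / m.+1%:R ^+ 2.
Proof.
rewrite natrM natrB ?leq_ord // /spectrum -mulr_natl.
have : (m.+1%:R : R) != 0 by rewrite pnatr_eq0.
by move: (m.+1%:R : R) (s%:R : R) => a b a0; field.
Qed.

Lemma spectrum_le1 s : spectrum s ^+ 2 <= 1.
Proof.
by rewrite -subr_ge0 spectrum_sq divr_ge0 ?mulr_ge0 ?ler0n // sqr_ge0.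
Qed.

Lemma spectrum_lt1 s : spectrum s ^+ 2 < 1 <-> exists s', s = inner_row s'.
Proof.
have -> : (spectrum s ^+ 2 < 1) = (0 < s * (m.+1 - s))%N.
  rewrite -subr_gt0 spectrum_sq pmulr_lgt0 ?invr_gt0 ?exprn_gt0 ?ltr0n //.
  by rewrite pmulr_rgt0 ?ltr0n.
rewrite muln_gt0 subn_gt0; split=> [/andP[s0 sm]|[s' ->]]; last first.
  by rewrite /= /bump leq0n /= (leqNgt m) ltn_ord /= !add0n add1n ltnS ltn_ord.
have sm1 : (s.-1 < m)%N by rewrite -ltnS prednK.
exists (Ordinal sm1); apply: val_inj.
by rewrite /= /bump leq0n /= (leqNgt m) sm1 /= add1n prednK.
Qed.

Variables (V : 'M[nat]_(m.+2, k)) (W : 'M[nat]_(m.+2, l)).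
Hypothesis VW : compatible V W.

Lemma compatible_sums s : spectrum s ^+ 2 < 1 -> (\sum_i V s i = \sum_j W s j)%N.
Proof. by case/spectrum_lt1 => s' ->; rewrite -!inner_sumsE (proj1 VW). Qed.

Lemma compatible_common i j :
  exists s, [/\ spectrum s ^+ 2 < 1, (0 < V s i)%N & (0 < W s j)%N].
Proof.
have := proj2 VW i j; rewrite mxE => pos.
have [s] : exists s : 'I_m, (0 < (inner_rows V s i * inner_rows W s j))%N.
  apply: contrapT => ns; move: pos; rewrite big1 // => s _.
  rewrite mxE; apply/eqP; rewrite -leqn0 leqNgt; apply/negP => h.
  by apply: ns; exists s.
rewrite muln_gt0 !inner_rowsE => /andP[Vs Ws]; exists (inner_row s); split=> //.
by apply/spectrum_lt1; exists s.
Qed.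

(** Each common inner row adds at least 1 to the entry of the product, so an entry below 2 leaves
    room for only one; larger entries fall under the hypothesis. *)
Lemma common_or_unique :
  (forall i j, (2 <= ((inner_rows V)^T *m inner_rows W) i j)%N ->
     exists s : 'I_m,
       (inner_rows V s i * inner_rows W s j)%N <> 0%N /\
       (2 <= inner_sums V s ord0)%N) ->
  forall i j, exists s, [/\ spectrum s ^+ 2 < 1, (0 < V s i)%N, (0 < W s j)%N &
     (2 <= \sum_i' V s i')%N \/
     forall s', spectrum s' ^+ 2 < 1 -> (0 < V s' i)%N -> (0 < W s' j)%N -> s' = s].
Proof.
move=> hyp i j.
case: (leqP 2 (((inner_rows V)^T *m inner_rows W) i j)) => [|lt2].
  case/hyp => s []; rewrite !inner_rowsE inner_sumsE => /eqP.
  rewrite -lt0n muln_gt0 => /andP[Vs Ws] two; exists (inner_row s); split=> //.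
    by apply/spectrum_lt1; exists s.
  by left.
have [s [ls Vs Ws]] := compatible_common i j.
exists s; split=> //; right=> s' ls' Vs' Ws'.
move/spectrum_lt1: ls Vs Ws => [e ->] Vs Ws.
move/spectrum_lt1: ls' Vs' Ws' => [e' ->] Vs' Ws'.
have [->//|ne] := eqVneq e' e; move: lt2; rewrite ltnNge => /negP[].
rewrite mxE (bigD1 e) //= (bigD1 e') //= addrA ![_^T _ _]mxE !inner_rowsE.
by apply: leq_trans (leq_addr _ _); rewrite -[2%N]/(1 + 1)%N leq_add // muln_gt0 ?Vs ?Ws ?Vs' ?Ws'.
Qed.

End Compatible.

(* The number of rows r >= 3 is written m.+2 with 0 < m. *)
Theorem theorem2p14 (R : realType) (G H : sgraph)
  (G_nonempty : (0 < #|G|)%N) (H_nonempty : (0 < #|H|)%N)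
  (k l m : nat) (m_gt0 : (0 < m)%N)
  (C : 'I_k -> {set G}) (E : 'I_l -> {set H})
  (compG : lists_components C) (compH : lists_components E)
  (V : 'M[nat]_(m.+2, k)) (W : 'M[nat]_(m.+2, l))
  (saneV : sane_matrix R C V) (saneW : sane_matrix R E W)
  (VW : compatible V W) :
  (forall i j, (2 <= ((inner_rows V)^T *m inner_rows W) i j)%N ->
     exists s : 'I_m,
       (inner_rows V s i * inner_rows W s j)%N <> 0%N /\
       (2 <= inner_sums V s ord0)%N)
  \/ gen_realisable_matrix R C V
  \/ gen_realisable_matrix R E W ->
  (q R (join G H) <= 2)%N.
Proof.
move=> cases.
have [sg sgV] := row_classes_exist (proj1 saneV).
have [tg tgW] := row_classes_exist (proj1 saneW).
have incr := @spectrum_incr R m; have le1 := @spectrum_le1 R m.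
have sums := compatible_sums (R:=R) VW; have common := compatible_common R VW.
have [Phi [Psi [M [[oP _ AP] [oQ _ AQ] cM nz]]]] : exists Phi Psi M,
    [/\ realises sg (@spectrum R m) Phi, realises tg (@spectrum R m) Psi,
        coupling (@spectrum R m) sg tg M & nowhere_zero (Phi *m M *m Psi^T)].
  case: cases => [hyp|[gV|gW]].
  - apply: (coupled_of_sane compG compH incr le1 sums sgV tgW) => //.
    exact: common_or_unique.
  - exact: (coupled_of_gen compG compH incr le1 sums sgV tgW).
  (* The roles of [G] and [H] are exchanged, and the resulting coupling is transposed. *)
  have sums' s : spectrum R s ^+ 2 < 1 -> (\sum_j W s j = \sum_i V s i)%N.
    by move/sums.
  have common' j i : exists s, [/\ spectrum R s ^+ 2 < 1, (0 < W s j)%N & (0 < V s i)%N].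
    by have [s []] := common i j; exists s.
  have [Psi [Phi [M [rQ rP cM nz]]]] :=
    coupled_of_gen compH compG incr le1 sums' tgW sgV H_nonempty gW saneV common'.
  exists Phi, Psi, M^T; split=> //; first exact: coupling_tr.
  move=> x y; have := nz y x.
  by rewrite -[Phi *m _ *m _]trmxK [X in _ -> X != 0]mxE !trmx_mul !trmxK mulmxA.
exact: (q_join_le2_coupling (comp_vertex_bij compG) (comp_vertex_bij compH) oP oQ AP AQ cM nz).
Qed.
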